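(* Let $\mathcal{H},\mathcal{K}$ be Hilbert spaces, let $S$ be a linear operator acting between $\mathcal{H}$ and $\mathcal{K}$, and let $T$ be a linear operator acting between $\mathcal{K}$ and $\mathcal{H}$. The following statements are equivalent: (i) (a) $S$ and $T$ are densely defined; (b) $S^*=T$ and $S=T^*$; (ii) (a) $S\wedge T$; (b) $\operatorname{ran} M_{S,T}(\lambda)=\mathcal{H}\times\mathcal{K}$ for a certain (and also for all) $\lambda\in\mathbb{R}$, $\lambda\neq 0$; (iii) (a) $S$ and $T$ are closed and densely defined; (b) $S\wedge T$; (c) $\operatorname{ran}(\lambda^2+ST)=\mathcal{K}$ and $\operatorname{ran}(\lambda^2+TS)=\mathcal{H}$ for a certain (and also for all) $\lambda\in\mathbb{R}$, $\lambda\neq0$. If $ST$ and $TS$ are also closed, then condition (iii)(c) can be replaced by (c') $\overline{\operatorname{ran}(\lambda^2+ST)}=\mathcal{K}$ and $\overline{\operatorname{ran}(\lambda^2+TS)}=\mathcal{H}$ for a certain (and also for all) $\lambda\in\mathbb{R}$, $\lambda\neq0$.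
   Context: Hilbert spaces are over the same scalar field, $\mathbb{R}$ or $\mathbb{C}$. A linear operator $S$ acting between $\mathcal{H}$ and $\mathcal{K}$ is a linear map $S:\operatorname{dom}S\to\mathcal{K}$ defined on a linear subspace $\operatorname{dom}S\subseteq\mathcal{H}$; it is not assumed bounded, closed or densely defined unless stated. Equality of operators includes equality of domains. Products and sums have their natural (maximal) domains: $\operatorname{dom}(ST)=\{k\in\operatorname{dom}T: Tk\in\operatorname{dom}S\}$, and $\lambda^2+ST$ is defined on $\operatorname{dom}(ST)$. The adjoint $S^*$ of a densely defined $S$ has domain $\{k\in\mathcal{K}:\exists h'\in\mathcal{H}\ \forall h\in\operatorname{dom}S,\ \langle Sh,k\rangle=\langle h,h'\rangle\}$ and $S^*k:=h'$. $S\wedge T$ (''$S$ and $T$ are adjoint to each other'') means $\langle Sh,k\rangle=\langle h,Tk\rangle$ for all $h\in\operatorname{dom}S$ and $k\in\operatorname{dom}T$. For a scalar $\lambda$, $M_{S,T}(\lambda)=\begin{pmatrix}\lambda&-T\\S&\lambda\end{pmatrix}$ is the operator on $\mathcal{H}\times\mathcal{K}$ with domain $\operatorname{dom}S\times\operatorname{dom}T$ given by $(h,k)\mapsto(\lambda h-Tk,\ Sh+\lambda k)$. ''For a certain (and also for all) $\lambda$'' means: the statement with ''for some $\lambda$'' and the statement with ''for all $\lambda$'' are both equivalent to the other listed statements. *)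

(* Defs.v *)
From HB Require Import structures.
From mathcomp Require Import all_boot all_order all_algebra.
From mathcomp Require Import complex.
From mathcomp Require Import boolp classical_sets reals topology normedtype.

Set Implicit Arguments.
Unset Strict Implicit.
Unset Printing Implicit Defensive.

Import Order.TTheory GRing.Theory Num.Theory.
Import numFieldNormedType.Exports.

Local Open Scope classical_set_scope.
Local Open Scope ring_scope.

Variant scalar_kind := RealScalars | ComplexScalars.

Definition scalar_field (R : realType) (s : scalar_kind) : numFieldType :=
  match s with RealScalars => R | ComplexScalars => R[i] end.

Definition sconj (R : realType) (s : scalar_kind) :
    {rmorphism scalar_field R s -> scalar_field R s} :=
  match s with RealScalars => idfun | ComplexScalars => @conjc R end.

Definition of_real (R : realType) (s : scalar_kind) :
    {rmorphism R -> scalar_field R s} :=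
  match s with RealScalars => idfun | ComplexScalars => real_complex R end.

HB.mixin Record CompleteNormedModule_isHilbert (R : realType) (s : scalar_kind)
    H & CompleteNormedModule (scalar_field R s) H := {
  inner : {dot H for @sconj R s} ;
  inner_norm : forall x : H, inner x x = `|x| ^+ 2
}.

(* The inner product is linear in its first argument and conjugate-linear in
   the second. *)
#[short(type="hilbertType")]
HB.structure Definition Hilbert (R : realType) (s : scalar_kind) :=
  {H of CompleteNormedModule (scalar_field R s) H
      & CompleteNormedModule_isHilbert R s H}.

Notation "'<[ x , y ]>" := (inner x y) (format "''<[' x ,  y ]>") : ring_scope.

Section InnerProduct.
Variables (R : realType) (s : scalar_kind) (H : hilbertType R s).
Implicit Types x y z : H.

Lemma innerC x y : '<[x, y]> = sconj R s '<[y, x]>.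
Proof. by rewrite (@hermitian_subproof _ _ false _ _ x y) mul1r. Qed.

Lemma innerBl x y z : '<[x - y, z]> = '<[x, z]> - '<[y, z]>.
Proof. exact: linearBl. Qed.

Lemma innerBr x y z : '<[x, y - z]> = '<[x, y]> - '<[x, z]>.
Proof. exact: linearBr. Qed.

Lemma inner0r x : '<[x, 0]> = 0.
Proof. exact: linear0r. Qed.

Lemma innerPr a x y z :
  '<[x, a *: y + z]> = sconj R s a * '<[x, y]> + '<[x, z]>.
Proof. exact: linearPr. Qed.

End InnerProduct.

Section Operators.
Variable F : numFieldType.

(* The values of [opfun] outside [dom] are irrelevant; equality of operators
   is therefore [op_eq] rather than Leibniz equality. *)
Record operator (U V : lmodType F) := Operator {
  dom : set U ;
  opfun :> U -> V ;
  dom_submod : submod_closed (mem dom) ;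
  opfun_linear : forall a : F,
    {in dom &, forall u v, opfun (a *: u + v) = a *: opfun u + opfun v}
}.

Definition op_eq (U V : lmodType F) (S T : operator U V) : Prop :=
  dom S = dom T /\ {in dom S, S =1 T}.

Lemma operator0 (U V : lmodType F) (S : operator U V) : S 0 = 0.
Proof.
have [S0 _] := dom_submod S; have := opfun_linear (o := S) (-1) S0 S0.
by rewrite scaleN1r oppr0 addr0 scaleN1r addNr.
Qed.

Definition ran (U V : lmodType F) (S : operator U V) : set V := S @` dom S.

Definition graph (U V : lmodType F) (S : operator U V) : set (U * V) :=
  [set p | p.1 \in dom S /\ p.2 = S p.1].

Section Comp.
Variables (U V W : lmodType F) (S : operator V W) (T : operator U V).

Definition comp_dom : set U := dom T `&` T @^-1` dom S.

Fact comp_dom_submod : submod_closed (mem comp_dom).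
Proof.
have [T0 TD] := dom_submod T; have [S0 SD] := dom_submod S.
split=> [|a u v]; rewrite !inE.
  split; first by move: T0; rewrite inE.
  by rewrite /= operator0; move: S0; rewrite inE.
move=> [Tu Su] [Tv Sv]; split.
  by have := TD a u v; rewrite !inE; apply.
by rewrite /= opfun_linear ?inE //; have := SD a (T u) (T v); rewrite !inE; apply.
Qed.

Fact comp_linear (a : F) :
  {in comp_dom &, forall u v, S (T (a *: u + v)) = a *: S (T u) + S (T v)}.
Proof.
move=> u v; rewrite !inE => -[Tu Su] [Tv Sv].
by rewrite !opfun_linear ?inE.
Qed.

Definition op_comp : operator U W := Operator comp_dom_submod comp_linear.
End Comp.

Section Shift.
Variables (U : lmodType F) (c : F) (S : operator U U).

Fact shift_linear (a : F) :
  {in dom S &, forall u v,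
     c *: (a *: u + v) + S (a *: u + v) = a *: (c *: u + S u) + (c *: v + S v)}.
Proof.
move=> u v Su Sv; rewrite opfun_linear // !scalerDr !scalerA (mulrC c).
by rewrite !addrA; congr (_ + _); rewrite -!addrA; congr (_ + _); rewrite addrC.
Qed.

(* c + S *)
Definition op_shift : operator U U :=
  Operator (dom_submod S) shift_linear.
End Shift.

Section Block.
Variables (U V : lmodType F) (S : operator U V) (T : operator V U) (c : F).

Definition block_fun (p : U * V) : U * V :=
  (c *: p.1 - T p.2, S p.1 + c *: p.2).

Fact block_submod : submod_closed (mem (dom S `*` dom T)).
Proof.
have [T0 TD] := dom_submod T; have [S0 SD] := dom_submod S.
split=> [|a p q]; rewrite !inE.
  by split; [move: S0|move: T0]; rewrite inE.
move=> [Sp Tp] [Sq Tq]; split.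
  by have := SD a p.1 q.1; rewrite !inE; apply.
by have := TD a p.2 q.2; rewrite !inE; apply.
Qed.

Fact block_linear (a : F) :
  {in dom S `*` dom T &, forall p q,
     block_fun (a *: p + q) = a *: block_fun p + block_fun q}.
Proof.
move=> p q; rewrite !inE => -[Sp Tp] [Sq Tq].
rewrite /block_fun /= !opfun_linear ?inE //; congr (_, _) => /=.
  rewrite !scalerDr !scalerA (mulrC c) opprD scalerN !addrA.
  by rewrite -!addrA; congr (_ + _); rewrite addrCA.
rewrite !scalerDr !scalerA (mulrC c) !addrA.
by rewrite -!addrA; congr (_ + _); rewrite addrCA.
Qed.

(* The operator matrix [[c, -T], [S, c]] *)
Definition op_block : operator (U * V)%type (U * V)%type :=
  Operator block_submod block_linear.
End Block.

End Operators.

Lemma dense_orthogonal (R : realType) (s : scalar_kind) (H : hilbertType R s)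
    (D : set H) (z : H) :
  dense D -> (forall h, h \in D -> '<[h, z]> = 0) -> z = 0.
Proof.
move=> dD Dz; apply/eqP; apply: contrapT => /negP z0.
have [||h [zh Dh]] := dD (ball z `|z|).
- by exists z; apply: ballxx; rewrite normr_gt0.
- exact: ball_open.
have hz : '<[h, z]> = 0 by apply: Dz; rewrite inE.
have zh0 : '<[z, h]> = 0.
  by rewrite innerC hz rmorph0.
move: zh; rewrite -ball_normE /ball_ /= => zh.
have : `|z - h| ^+ 2 < `|z| ^+ 2 by rewrite ltr_pXn2r ?nnegrE.
rewrite -inner_norm innerBr !innerBl.
rewrite hz zh0 subr0 sub0r opprK !inner_norm gtrDl.
by rewrite le_gtF ?exprn_ge0.
Qed.

Section HilbertOperators.
Variables (R : realType) (s : scalar_kind) (H K : hilbertType R s).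

Definition densely_defined (S : operator H K) : Prop := dense (dom S).

(* The product topology on [H * K] is that of the Hilbert space direct sum. *)
Definition closed_op (S : operator H K) : Prop := closed (graph S).

Definition adjoint_pair (S : operator H K) (T : operator K H) : Prop :=
  forall h k, h \in dom S -> k \in dom T -> '<[S h, k]> = '<[h, T k]>.

Section Adjoint.
Variable S : operator H K.

Definition adjoint_value (k : K) : set H :=
  [set h' | forall h, h \in dom S -> '<[S h, k]> = '<[h, h']>].

Definition adjoint_dom : set K := [set k | adjoint_value k !=set0].

Definition adjoint_fun (k : K) : H := xget 0 (adjoint_value k).

Lemma adjoint_value_linear (a : scalar_field R s) (u v : K) (u' v' : H) :
  adjoint_value u u' -> adjoint_value v v' ->
  adjoint_value (a *: u + v) (a *: u' + v').
Proof.
move=> uE vE h Sh; by rewrite !innerPr uE // vE.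
Qed.

Fact adjoint_submod : submod_closed (mem adjoint_dom).
Proof.
split=> [|a u v]; rewrite !inE.
  by exists 0 => h Sh; rewrite !inner0r.
move=> [u' uE] [v' vE]; exists (a *: u' + v').
exact: adjoint_value_linear.
Qed.

Hypothesis dS : densely_defined S.

Fact adjoint_linear (a : scalar_field R s) :
  {in adjoint_dom &, forall u v,
     adjoint_fun (a *: u + v) = a *: adjoint_fun u + adjoint_fun v}.
Proof.
move=> u v; rewrite !inE => Su Sv.
have valP k : adjoint_dom k -> adjoint_value k (adjoint_fun k).
  by case=> h' kh'; rewrite /adjoint_fun; case: xgetP => // /(_ h').
have lin := adjoint_value_linear a (valP _ Su) (valP _ Sv).
apply/eqP; rewrite -subr_eq0; apply/eqP.
apply: (dense_orthogonal dS) => h Sh; rewrite innerBr.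
by rewrite -(lin h Sh) -(valP (a *: u + v) (ex_intro _ _ lin) h Sh) subrr.
Qed.

Definition adjoint : operator K H := Operator adjoint_submod adjoint_linear.
End Adjoint.

End HilbertOperators.

(* Main.v *)
Require Import Defs.
From mathcomp Require Import all_boot all_order all_algebra complex.
From mathcomp Require Import boolp classical_sets reals topology normedtype.
From mathcomp Require Import lra ring.

Set Implicit Arguments.
Unset Strict Implicit.
Unset Printing Implicit Defensive.

Import Order.TTheory GRing.Theory Num.Theory.
Import numFieldNormedType.Exports.

Local Open Scope classical_set_scope.
Local Open Scope ring_scope.

(** Suppose first that S and T are mutual adjoints, and
    let D be the set of pairs (l h, S h) with h in the domain of S.  As S is
    itself an adjoint, D is an orthogonal complement, hence closed, and every
    (f, g) splits as (l h, S h) + w with w orthogonal to D.  Orthogonality to D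
    says precisely that k = w.2 / l lies in the domain of the adjoint of S,
    which is T, and that T k = - w.1.  So (f, g) = (l h - T k, S h + l k), and
    the block operator is onto ([adjoint_block]).

    Conversely let S and T be adjoint to each other with an onto block operator
    for one real l <> 0.  Everything follows from a single rigidity fact
    ([block_kernel]): if S h = - l k and the adjoint of S takes k to l h, then
    l (|h|^2 + |k|^2) = 0, so h = k = 0.  Solving the block equation for (z, 0)
    with z orthogonal to the domain of S shows that S is densely defined; solving
    it for (- h', l k), where h' is the value of the adjoint of S at k, shows
    that k lies in the domain of T.  Exchanging the two operators only changes
    signs in the block operator ([block_swap]), so the same holds for T.

    Surjectivity of the block operator and of the two shifted products is
    related by direct substitution: the pair (T k, l k) is mapped to
    (0, (l^2 + S T) k) and (l h, - S h) to ((l^2 + T S) h, 0).  Finally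
    l^2 + S T is bounded below, because <S T k, k> = |T k|^2 >= 0; if S T is
    closed then its range is closed, so that a dense range is everything.

    The one analytic ingredient is the projection theorem
    ([orthogonal_projection]), needed in both H and H * K.  The norm of H * K
    does not come from an inner product, so the theorem is proved for any vector
    space with an inner product whose Cauchy sequences converge.  Squared norms
    and real parts of inner products are kept in R, which treats real and
    complex scalars alike and gives access to infima. *)

(** * Real parts of scalars *)

Definition repart (R : realType) (s : scalar_kind) : scalar_field R s -> R :=
  match s with RealScalars => id | ComplexScalars => @complex.Re R end.

Section Scalars.
Variables (R : realType) (s : scalar_kind).
Implicit Types (z w : scalar_field R s) (a b : R).

Lemma repartD z w : repart (z + w) = repart z + repart w.
Proof. by case: s z w => //= -[? ?] [? ?]. Qed.

Lemma repartN z : repart (- z) = - repart z.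
Proof. by case: s z => //= -[]. Qed.

Lemma repartB z w : repart (z - w) = repart z - repart w.
Proof. by rewrite repartD repartN. Qed.

Lemma repart_of_real a : repart (of_real R s a) = a.
Proof. by case: s. Qed.

Lemma repartZ a z : repart (of_real R s a * z) = a * repart z.
Proof. by case: s z => //= -[x y] /=; rewrite mul0r subr0. Qed.

Lemma sconj_of_real a : sconj R s (of_real R s a) = of_real R s a.
Proof. by case: s => //=; exact: conjc_real. Qed.

Lemma repart_sconj z : repart (sconj R s z) = repart z.
Proof. by case: s z => //= -[]. Qed.

Lemma repart_conj_eq0 z : repart (sconj R s z * z) = 0 -> z = 0.
Proof.
case: s z => /= [z /eqP|[x y] /= /eqP]; first by rewrite mulf_eq0 orbb => /eqP.
rewrite mulNr opprK -!expr2 paddr_eq0 ?sqr_ge0 // !sqrf_eq0.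
by move=> /andP[/eqP-> /eqP->].
Qed.

(** Nonnegative complex numbers are real in the order on [R[i]]. *)
Lemma ge0_of_real z : 0 <= z -> z = of_real R s (repart z).
Proof.
case: s z => //= -[x y]; rewrite lecE /= => /andP[/eqP -> _].
by [].
Qed.

Lemma ler_of_real a b : (of_real R s a <= of_real R s b) = (a <= b).
Proof. by case: s => //=; exact: lecR. Qed.

Lemma ltr_of_real a b : (of_real R s a < of_real R s b) = (a < b).
Proof. by case: s => //=; exact: ltcR. Qed.

End Scalars.

(** The minimum of the quadratic is at [t = a / q]; when [q = 0] it is affine
    and nonnegative, so [a = 0].  Both Cauchy-Schwarz and the near-orthogonality
    of near-minimizers are instances. *)
Lemma discriminant_le (R : realFieldType) (p a q : R) :
  0 <= q -> (forall t, 0 <= p - 2 * t * a + t ^+ 2 * q) -> a ^+ 2 <= p * q.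
Proof.
move=> q0 pos; have [q_eq0|q_neq0] := eqVneq q 0.
  have := pos ((p + 1) / (2 * a)); have := pos 0; rewrite q_eq0.
  have [->|a0] := eqVneq a 0; first by nra.
  have -> : 2 * ((p + 1) / (2 * a)) * a = p + 1 by field.
  lra.
have := pos (a / q); rewrite -(@ler_pM2r _ q) ?lt_def ?q_neq0 // mul0r.
have -> : (p - 2 * (a / q) * a + (a / q) ^+ 2 * q) * q = p * q - a ^+ 2.
  by field.
by rewrite subr_ge0.
Qed.

Lemma eq0_small (R : realFieldType) (x : R) :
  0 <= x -> (forall e, 0 < e -> x < e) -> x = 0.
Proof.
move=> x0 small; apply/eqP; rewrite eq_le x0 andbT leNgt; apply/negP => /small.
by rewrite ltxx.
Qed.

(** * Inner product spaces *)

(** Positive semidefinite hermitian forms, kept apart from any norm on [V] so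
    that the forms of [H] and [K] add up to one on [H * K], whose norm is the
    maximum of the two norms. *)
Record inner_product (R : realType) (s : scalar_kind)
    (V : lmodType (scalar_field R s)) := InnerProduct {
  ip :> V -> V -> scalar_field R s ;
  ip_linear : forall a x y z, ip (a *: x + y) z = a * ip x z + ip y z ;
  ipC : forall x y, ip x y = sconj R s (ip y x) ;
  ip_ge0 : forall x, 0 <= ip x x
}.

Section InnerProductSpace.
Variables (R : realType) (s : scalar_kind) (V : lmodType (scalar_field R s)).
Variable B : inner_product V.
Local Notation real := (of_real R s).
Implicit Types (x y z : V) (A D : set V) (u : nat -> V) (t : R).

Definition sqn x : R := repart (B x x).

Lemma ip0l y : B 0 y = 0.
Proof.
have := ip_linear B 1 0 0 y; rewrite scale1r addr0 mul1r => /eqP.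
by rewrite -subr_eq0 opprD addNKr oppr_eq0 => /eqP.
Qed.

Lemma ipZl a x y : B (a *: x) y = a * B x y.
Proof. by rewrite -[a *: x]addr0 ip_linear ip0l addr0. Qed.

Lemma ipDl x y z : B (x + y) z = B x z + B y z.
Proof. by rewrite -[x]scale1r ip_linear mul1r scale1r. Qed.

Lemma ipBl x y z : B (x - y) z = B x z - B y z.
Proof. by rewrite addrC -scaleN1r ip_linear mulN1r addrC. Qed.

Lemma ipZr a x y : B x (a *: y) = sconj R s a * B x y.
Proof. by rewrite ipC ipZl rmorphM -ipC. Qed.

Definition rip x y : R := repart (B x y).

Lemma ripC x y : rip x y = rip y x.
Proof. by rewrite /rip ipC repart_sconj. Qed.

Lemma ripDl x y z : rip (x + y) z = rip x z + rip y z.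
Proof. by rewrite /rip ipDl repartD. Qed.

Lemma ripBl x y z : rip (x - y) z = rip x z - rip y z.
Proof. by rewrite /rip ipBl repartB. Qed.

Lemma ripZl t x z : rip (real t *: x) z = t * rip x z.
Proof. by rewrite /rip ipZl repartZ. Qed.

Lemma ripDr x y z : rip z (x + y) = rip z x + rip z y.
Proof. by rewrite ripC ripDl !(ripC z). Qed.

Lemma ripBr x y z : rip z (x - y) = rip z x - rip z y.
Proof. by rewrite ripC ripBl !(ripC z). Qed.

Lemma ripZr t x z : rip z (real t *: x) = t * rip z x.
Proof. by rewrite ripC ripZl ripC. Qed.

Lemma sqn_ge0 x : 0 <= sqn x.
Proof.
by rewrite -(ler_of_real s) rmorph0 -ge0_of_real ip_ge0.
Qed.

Lemma ip_sqn x : B x x = real (sqn x).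
Proof. by rewrite -ge0_of_real ?ip_ge0. Qed.

Lemma sqnE x : sqn x = rip x x. Proof. by []. Qed.

Lemma sqnBZ x y t :
  sqn (x - real t *: y) = sqn x - 2 * t * rip x y + t ^+ 2 * sqn y.
Proof. rewrite !sqnE !(ripBl, ripBr, ripZl, ripZr) (ripC y x); ring. Qed.

Lemma sqnB x y : sqn (x - y) = sqn x - 2 * rip x y + sqn y.
Proof. rewrite !sqnE !(ripBl, ripBr, ripZl, ripZr) (ripC y x); ring. Qed.

Lemma sqnBC x y : sqn (x - y) = sqn (y - x).
Proof. by rewrite !sqnB (ripC x y); ring. Qed.

(** The Cauchy-Schwarz inequality. *)
Lemma rip_sqr_le x y : rip x y ^+ 2 <= sqn x * sqn y.
Proof.
by apply: discriminant_le (sqn_ge0 y) _ => t; rewrite -sqnBZ sqn_ge0.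
Qed.

Lemma sqnD_le x y : sqn (x + y) <= 2 * sqn x + 2 * sqn y.
Proof.
have := sqn_ge0 (x - y); rewrite sqnB.
have -> : sqn (x + y) = sqn x + 2 * rip x y + sqn y.
  by rewrite !sqnE !(ripDl, ripDr) (ripC y x); ring.
lra.
Qed.

(** Testing against [B z d *: d] turns the real part into [|B z d|^2], so in a
    subspace real orthogonality is full orthogonality. *)
Lemma orthogonal_rip D : submod_closed (mem D) -> forall z,
  (forall d, D d -> rip z d = 0) -> forall d, D d -> B z d = 0.
Proof.
move=> [D0 DD] z zD d Dd; apply: repart_conj_eq0.
rewrite -ipZr; apply: zD.
by have := DD (B z d) d 0; rewrite addr0 !inE; apply=> //; move: D0; rewrite inE.
Qed.

(** Metric closure for the form; it is the topological closure in a Hilbert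
    space ([closure_adherent]) and in a product of two
    ([closure_adherent_prod]). *)
Definition adherent A x : Prop :=
  forall e : R, 0 < e -> exists2 a, A a & sqn (a - x) < e.

Definition conv u x : Prop :=
  forall e : R, 0 < e -> exists N, forall n, (N <= n)%N -> sqn (u n - x) < e.

Definition cauchy_seq u : Prop :=
  forall e : R, 0 < e ->
    exists N, forall m n, (N <= m)%N -> (N <= n)%N -> sqn (u m - u n) < e.

Definition complete_ip : Prop := forall u, cauchy_seq u -> exists x, conv u x.

Lemma conv_adherent A u x : (forall n, A (u n)) -> conv u x -> adherent A x.
Proof.
by move=> Au ux e /ux[N uN]; exists (u N) => //; exact: uN.
Qed.

(** Orthogonal complements are closed: by Cauchy-Schwarz [B z d] differs little
    from [B w d = 0] for [w] near [z]. *)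
Lemma adherent_orthogonal D z :
  adherent [set w | forall d, D d -> B w d = 0] z ->
  forall d, D d -> B z d = 0.
Proof.
move=> zD d Dd; apply: repart_conj_eq0.
(* with [e = B z d *: d], the number to be shown zero is [rip z e] *)
rewrite -ipZr -/(rip _ _); set e := _ *: d.
apply/eqP; rewrite -sqrf_eq0; apply/eqP; apply: eq0_small (sqr_ge0 _) _ => r r0.
have q1 : 0 < sqn e + 1 by rewrite ltr_wpDl ?sqn_ge0.
have [w wD wz] := zD (r / (sqn e + 1)) (divr_gt0 r0 q1).
have we : rip w e = 0.
  by rewrite /rip ipZr wD // mulr0 -(rmorph0 real) repart_of_real.
have := rip_sqr_le (w - z) e; rewrite ripBl we sub0r sqrrN => /le_lt_trans; apply.
rewrite ltr_pdivlMr // in wz; apply: le_lt_trans wz.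
by rewrite ler_wpM2l ?sqn_ge0 // lerDl.
Qed.

Lemma inv_small (e : R) : 0 < e ->
  exists N, forall n, (N <= n)%N -> n.+1%:R^-1 < e.
Proof.
move=> e0; exists (Num.truncn e^-1) => n Nn.
rewrite -[e]invrK ltf_pV2 ?posrE ?invr_gt0 //.
by apply: lt_le_trans (truncnS_gt _) _; rewrite ler_nat.
Qed.

Lemma adherent_conv A x : adherent A x ->
  exists2 u, (forall n, A (u n)) & conv u x.
Proof.
move=> Ax; have /choice[u uP] n : exists a, A a /\ sqn (a - x) < n.+1%:R^-1.
  by have [|a Aa ax] := Ax n.+1%:R^-1; [rewrite invr_gt0 | exists a].
exists u => [n|e /inv_small[N NP]]; first by have [] := uP n.
by exists N => n /NP; apply: lt_trans; have [] := uP n.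
Qed.

Lemma conv_cauchy u x : conv u x -> cauchy_seq u.
Proof.
move=> ux e e0; have e4 : 0 < e / 4 by rewrite divr_gt0.
have [N NP] := ux _ e4; exists N => m n /NP um /NP un.
have -> : u m - u n = (u m - x) + (x - u n) by rewrite addrA subrK.
apply: le_lt_trans (sqnD_le _ _) _; rewrite (sqnBC x); lra.
Qed.

Lemma eq_conv u v x : u =1 v -> conv v x -> conv u x.
Proof. by move=> uv vx e /vx[N NP]; exists N => n; rewrite uv; exact: NP. Qed.

Lemma convBZ t u v x y : conv u x -> conv v y ->
  conv (fun n => u n - real t *: v n) (x - real t *: y).
Proof.
move=> ux vy e e0; have e4 : 0 < e / 4 by rewrite divr_gt0.
have t0 : 0 < 4 * (t ^+ 2 + 1) by rewrite mulr_gt0 // ltr_wpDl ?sqr_ge0.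
have [N NP] := ux _ e4; have [M MP] := vy _ (divr_gt0 e0 t0).
exists (maxn N M) => n; rewrite geq_max => /andP[/NP un /MP vn].
have -> : u n - real t *: v n - (x - real t *: y) =
    (u n - x) + real t *: (y - v n).
  by rewrite scalerBr !opprB addrACA [RHS]addrACA; congr (_ + _); rewrite addrC.
apply: le_lt_trans (sqnD_le _ _) _.
have -> : sqn (real t *: (y - v n)) = t ^+ 2 * sqn (v n - y).
  by rewrite sqnBC !sqnE ripZl ripZr mulrA.
rewrite ltr_pdivlMr // in vn; have := sqn_ge0 (v n - y); move: vn un.
move: (sqn _) (sqn _) (t ^+ 2) => a b r; lra.
Qed.

(** A sequence of near-minimizers of the distance from [x] to [D] is Cauchy by
    the parallelogram identity.  Each near-minimizer [u n] is nearly orthogonal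
    to [D], by the discriminant bound along every line in [D]; this passes to
    the limit by Cauchy-Schwarz. *)
Lemma orthogonal_projection D : submod_closed (mem D) -> complete_ip ->
  forall x, exists2 y, adherent D y & forall d, D d -> B (x - y) d = 0.
Proof.
move=> Dsub cV x; have [D0 DD] := Dsub.
have {}D0 : D 0 by move: D0; rewrite inE.
have {}DD (a : scalar_field R s) (v w : V) : D v -> D w -> D (a *: v + w).
  by move=> Dv Dw; have := DD a v w; rewrite !inE; apply.
pose dists := [set sqn (x - d) | d in D].
have has_inf_dists : has_inf dists.
  split; first by exists (sqn (x - 0)); exists 0.
  by exists 0 => _ [d _ <-]; exact: sqn_ge0.
have inf_le d : D d -> inf dists <= sqn (x - d).
  by move=> Dd; apply: ge_inf; [case: has_inf_dists | exists d].
have /choice[u uP] n :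
    exists d, D d /\ sqn (x - d) < inf dists + n.+1%:R^-1.
  have [|_ [d Dd <-] xd] := @inf_adherent _ dists n.+1%:R^-1 _ has_inf_dists.
    by rewrite invr_gt0.
  by exists d.
have Du n : D (u n) by have [] := uP n.
have ud n : sqn (x - u n) < inf dists + n.+1%:R^-1 by have [] := uP n.
have cu : cauchy_seq u.
  move=> e e0; have [|N NP] := @inv_small (e / 4); first by rewrite divr_gt0.
  exists N => m n /NP Nm /NP Nn.
  have mid : sqn (u m - u n) = 2 * sqn (x - u m) + 2 * sqn (x - u n)
      - 4 * sqn (x - real 2^-1 *: (u m + u n)).
    by rewrite !sqnE !(ripBl, ripBr, ripZl, ripZr, ripDl, ripDr) !(ripC _ x)
       (ripC (u n)); field.
  have Dmid : D (real 2^-1 *: (u m + u n)).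
    by rewrite -[_ *: _]addr0; apply: (DD) => //; rewrite -[u m]scale1r; exact: DD.
  move: (inf_le _ Dmid) (ud m) (ud n) Nm Nn; rewrite mid.
  move: (sqn (x - _)) (sqn (x - u m)) (sqn (x - u n)) (inf dists) => a b c i.
  move: (m.+1%:R^-1) (n.+1%:R^-1) => p q. lra.
have [y uy] := cV u cu; exists y; first exact: conv_adherent uy.
apply: orthogonal_rip Dsub _ _ => d Dd.
(* the square of [rip (x - y) d] is at most twice the sum of the squares for
   [x - u n] and [u n - y], whence the constant 4 for a bound by [r] *)
apply/eqP; rewrite -sqrf_eq0; apply/eqP; apply: eq0_small (sqr_ge0 _) _ => r r0.
have q1 : 0 < sqn d + 1 by rewrite ltr_wpDl ?sqn_ge0.
have r1 : 0 < r / (4 * (sqn d + 1)) by rewrite divr_gt0 // mulr_gt0.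
have [N NP] := inv_small r1; have [N' NP'] := uy _ r1.
have {NP'}yn := NP' _ (leq_maxr N N'); have {NP}dn := NP _ (leq_maxl N N').
move: (maxn N N') yn dn => n yn dn.
have near_min : rip (x - u n) d ^+ 2 <= n.+1%:R^-1 * sqn d.
  apply: discriminant_le (sqn_ge0 d) _ => t.
  have := inf_le _ (DD (real t) _ _ Dd (Du n)).
  rewrite [_ + u n]addrC opprD addrA sqnBZ; move: (ud n).
  move: (sqn (x - _)) (inf dists) => a i; move: (n.+1%:R^-1) => p; lra.
have := rip_sqr_le (u n - y) d.
have -> : rip (x - y) d = rip (x - u n) d + rip (u n - y) d.
  by rewrite -ripDl addrA subrK.
rewrite ltr_pdivlMr ?mulr_gt0 // in yn; rewrite ltr_pdivlMr ?mulr_gt0 // in dn.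
have := sqn_ge0 (u n - y).
have : 0 <= n.+1%:R^-1 :> R by rewrite invr_ge0.
move: (rip _ _) (rip _ _) near_min yn dn (sqn_ge0 d) => a b.
move: (n.+1%:R^-1) (sqn _) (sqn d) => p q Q *.
have : (a + b) ^+ 2 <= 2 * a ^+ 2 + 2 * b ^+ 2.
  by rewrite -subr_ge0; have := sqr_ge0 (a - b); rewrite !expr2; nra.
lra.
Qed.

End InnerProductSpace.

(** * Hilbert spaces and their products *)

Section HilbertSpace.
Variables (R : realType) (s : scalar_kind) (H : hilbertType R s).
Local Notation real := (of_real R s).

Fact hilbert_ip_linear a (x y z : H) :
  '<[a *: x + y, z]> = a * '<[x, z]> + '<[y, z]>.
Proof. exact: linearPl. Qed.

Fact hilbert_ip_ge0 (x : H) : 0 <= '<[x, x]>.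
Proof. by rewrite inner_norm exprn_ge0. Qed.

Definition hilbert_ip : inner_product H :=
  InnerProduct hilbert_ip_linear (@innerC R s H) hilbert_ip_ge0.

Local Notation q := (sqn hilbert_ip).

Lemma normr_lt_real (x : H) (e : R) : 0 < e -> (`|x| < real e) = (q x < e ^+ 2).
Proof.
move=> e0; have re0 : 0 <= real e by rewrite -(rmorph0 real) ler_of_real ltW.
rewrite -(@ltr_pXn2r _ 2) ?nnegrE // -inner_norm -rmorphXn.
by rewrite [inner x x](ip_sqn hilbert_ip) ltr_of_real.
Qed.

Lemma real_gt0 (e : R) : (0 < real e) = (0 < e).
Proof. by rewrite -(rmorph0 real) ltr_of_real. Qed.

Lemma gt0_real (e : scalar_field R s) : 0 < e -> exists2 r : R, 0 < r & e = real r.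
Proof.
move=> e0; have eE := ge0_of_real (ltW e0); exists (repart e) => //.
by rewrite -real_gt0 -eE.
Qed.

Lemma ball_sqn (x y : H) (e : R) : 0 < e -> ball x (real e) y <-> q (y - x) < e ^+ 2.
Proof. by move=> e0; rewrite -ball_normE /ball_ /= normr_lt_real // sqnBC. Qed.

Lemma sqn_eq0 (x : H) : q x = 0 -> x = 0.
Proof.
move=> x0; apply/normr0_eq0/eqP; rewrite -sqrf_eq0 -inner_norm.
by rewrite [inner x x](ip_sqn hilbert_ip) x0 rmorph0.
Qed.

Lemma hilbert_complete : complete_ip hilbert_ip.
Proof.
move=> u cu; have /cauchy_cvg/cvg_ballP cvu : cauchy (u @ \oo).
  apply/cauchy_exP => _ /gt0_real[e e0 ->].
  have [|N NP] := cu (e ^+ 2); first by rewrite exprn_gt0.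
  by exists (u N); exists N => // n /= Nn; apply/ball_sqn => //; exact: NP.
exists (lim (u @ \oo)) => e e0.
have [N _ NP] := cvu (real (Num.sqrt e)) ltac:(by rewrite real_gt0 sqrtr_gt0).
exists N => n /NP /=; move/ball_sqn.
by rewrite sqrtr_gt0 sqr_sqrtr ?ltW //; exact.
Qed.

Lemma closure_adherent (A : set H) : closure A = adherent hilbert_ip A.
Proof.
apply/seteqP; split=> x.
  move=> Ax e e0; have s0 : 0 < Num.sqrt e by rewrite sqrtr_gt0.
  have [|a [Aa /ball_sqn]] := Ax (ball x (real (Num.sqrt e))).
    by apply: nbhsx_ballx; rewrite real_gt0.
  by rewrite sqr_sqrtr ?ltW // => /(_ s0); exists a.
move=> Ax U /nbhs_ballP[_ /gt0_real[e e0 ->] eU].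
have [|a Aa ax] := Ax (e ^+ 2); first by rewrite exprn_gt0.
by exists a; split=> //; apply/eU/ball_sqn.
Qed.

Lemma adherent_dense (A : set H) : (forall x, adherent hilbert_ip A x) -> dense A.
Proof.
move=> AT U [x Ux] oU; have : closure A x by rewrite closure_adherent.
by move=> /(_ U) []; [exact: open_nbhs_nbhs | move=> a [Aa Ua]; exists a].
Qed.

End HilbertSpace.

Section Product.
Variables (R : realType) (s : scalar_kind) (V W : lmodType (scalar_field R s)).
Variables (P : inner_product V) (Q : inner_product W).

Fact prod_ip_linear a (x y z : V * W) :
  P (a *: x + y).1 z.1 + Q (a *: x + y).2 z.2 =
  a * (P x.1 z.1 + Q x.2 z.2) + (P y.1 z.1 + Q y.2 z.2).
Proof. by rewrite /= !ip_linear mulrDr addrACA. Qed.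

Fact prod_ipC (x y : V * W) :
  P x.1 y.1 + Q x.2 y.2 = sconj R s (P y.1 x.1 + Q y.2 x.2).
Proof. by rewrite rmorphD -!ipC. Qed.

Fact prod_ip_ge0 (x : V * W) : 0 <= P x.1 x.1 + Q x.2 x.2.
Proof. by rewrite addr_ge0 ?ip_ge0. Qed.

Definition prod_ip : inner_product (V * W)%type :=
  InnerProduct prod_ip_linear prod_ipC prod_ip_ge0.

Lemma prod_ipE x y : prod_ip x y = P x.1 y.1 + Q x.2 y.2. Proof. by []. Qed.

Lemma sqn_prod x : sqn prod_ip x = sqn P x.1 + sqn Q x.2.
Proof. exact: repartD. Qed.

Lemma sqn_fst x : sqn P x.1 <= sqn prod_ip x.
Proof. by rewrite sqn_prod lerDl sqn_ge0. Qed.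

Lemma sqn_snd x : sqn Q x.2 <= sqn prod_ip x.
Proof. by rewrite sqn_prod lerDr sqn_ge0. Qed.

Lemma conv_prod u p :
  conv P (fst \o u) p.1 -> conv Q (snd \o u) p.2 -> conv prod_ip u p.
Proof.
move=> u1 u2 e e0; have e2 : 0 < e / 2 by rewrite divr_gt0.
have [N NP] := u1 _ e2; have [M MP] := u2 _ e2.
exists (maxn N M) => n; rewrite geq_max => /andP[/NP n1 /MP n2].
by rewrite sqn_prod [e]splitr ltrD.
Qed.

Lemma complete_prod : complete_ip P -> complete_ip Q -> complete_ip prod_ip.
Proof.
move=> cP cQ u cu.
have [e e0|x ux] := cP (fst \o u).
  have [N NP] := cu e e0; exists N => m n Nm Nn.
  by apply: le_lt_trans (NP m n Nm Nn); exact: (sqn_fst (u m - u n)).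
have [e e0|y uy] := cQ (snd \o u).
  have [N NP] := cu e e0; exists N => m n Nm Nn.
  by apply: le_lt_trans (NP m n Nm Nn); exact: (sqn_snd (u m - u n)).
by exists (x, y); exact: conv_prod.
Qed.

End Product.

Section HilbertProduct.
Variables (R : realType) (s : scalar_kind) (H K : hilbertType R s).
Local Notation B := (prod_ip (hilbert_ip H) (hilbert_ip K)).

Lemma closure_adherent_prod (A : set (H * K)) : closure A = adherent B A.
Proof.
apply/seteqP; split=> x.
  move=> Ax e e0; have e2 : 0 < e / 2 by rewrite divr_gt0.
  have s0 : 0 < Num.sqrt (e / 2) by rewrite sqrtr_gt0.
  have [|a [Aa [/(ball_sqn _ _ s0) a1 /(ball_sqn _ _ s0) a2]]] :=
      Ax (ball x (of_real R s (Num.sqrt (e / 2)))).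
    by apply: nbhsx_ballx; rewrite real_gt0.
  exists a => //; move: a1 a2; rewrite sqr_sqrtr ?(ltW e2) // => a1 a2.
  by rewrite sqn_prod [e]splitr ltrD.
move=> Ax U /nbhs_ballP[_ /gt0_real[e e0 ->] eU].
have [|a Aa ax] := Ax (e ^+ 2); first by rewrite exprn_gt0.
exists a; split=> //; apply: eU; split; apply/ball_sqn => //.
  exact: le_lt_trans (sqn_fst _ _ (a - x)) ax.
exact: le_lt_trans (sqn_snd _ _ (a - x)) ax.
Qed.

Lemma closed_adherent (A : set (H * K)) :
  closed A <-> forall p, adherent B A p -> A p.
Proof. by rewrite /closed closure_adherent_prod. Qed.

End HilbertProduct.

(** * Operators and their adjoints *)

Section OperatorLinearity.
Variables (F : numFieldType) (U V : lmodType F) (S : operator U V).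

Lemma dom0 : dom S 0.
Proof. by have [+ _] := dom_submod S; rewrite inE. Qed.

Lemma dom_lin a u v : dom S u -> dom S v -> dom S (a *: u + v).
Proof. by have [_ DD] := dom_submod S; have := DD a u v; rewrite !inE; apply. Qed.

Lemma domZ a u : dom S u -> dom S (a *: u).
Proof. by move=> Su; rewrite -[_ *: _]addr0; apply: dom_lin => //; exact: dom0. Qed.

Lemma domD u v : dom S u -> dom S v -> dom S (u + v).
Proof. by move=> Su Sv; rewrite -[u]scale1r; exact: dom_lin. Qed.

Lemma domN u : dom S u -> dom S (- u).
Proof. by rewrite -scaleN1r; exact: domZ. Qed.

Lemma domB u v : dom S u -> dom S v -> dom S (u - v).
Proof. by move=> Su /domN; exact: domD. Qed.

Lemma opZ a u : dom S u -> S (a *: u) = a *: S u.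
Proof.
move=> Su; rewrite -[a *: u]addr0 opfun_linear ?inE //; last exact: dom0.
by rewrite operator0 addr0.
Qed.

Lemma opD u v : dom S u -> dom S v -> S (u + v) = S u + S v.
Proof. by move=> Su Sv; rewrite -[u]scale1r opfun_linear ?inE // !scale1r. Qed.

Lemma opN u : dom S u -> S (- u) = - S u.
Proof. by move=> Su; rewrite -scaleN1r opZ // scaleN1r. Qed.

Lemma opB u v : dom S u -> dom S v -> S (u - v) = S u - S v.
Proof. by move=> Su Sv; rewrite opD ?opN //; exact: domN. Qed.

Lemma ran_full : ran S = [set: V] <-> forall y, exists2 x, dom S x & S x = y.
Proof.
split=> [rS y|rS]; first by have : ran S y by rewrite rS.
by apply/seteqP; split=> // y _; have [x] := rS y; exists x.
Qed.

End OperatorLinearity.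

Section Adjoints.
Variables (R : realType) (s : scalar_kind) (H K : hilbertType R s).
Implicit Types (S : operator H K) (T : operator K H).

Lemma adjoint_pairP S T : adjoint_pair S T <->
  forall k, dom T k -> adjoint_value S k (T k).
Proof.
split=> ST; first by move=> k Tk h Sh; apply: ST => //; rewrite inE.
by move=> h k Sh; rewrite inE => /ST; apply.
Qed.

Lemma adjoint_fun_value S k : adjoint_dom S k -> adjoint_value S k (adjoint_fun S k).
Proof. by case=> h' kh'; rewrite /adjoint_fun; case: xgetP => // /(_ h'). Qed.

Lemma adjoint_value_unique S k x y : densely_defined S ->
  adjoint_value S k x -> adjoint_value S k y -> x = y.
Proof.
move=> dS kx ky; apply/eqP; rewrite -subr_eq0; apply/eqP.
by apply: (dense_orthogonal dS) => h Sh; rewrite innerBr -kx // -ky // subrr.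
Qed.

(** An adjoint pair already gives that [T] is a restriction of the adjoint of
    [S]; what remains is inclusion of domains. *)
Lemma adjoint_eqP S T (dS : densely_defined S) :
  op_eq (adjoint dS) T <->
  adjoint_pair S T /\ forall k h', adjoint_value S k h' -> dom T k.
Proof.
split=> [[dE fE]|[/adjoint_pairP ST sub]].
  split; last by move=> k h' kh'; rewrite -dE; exists h'.
  apply/adjoint_pairP => k; rewrite -dE => Ak; rewrite -fE ?inE //.
  exact: adjoint_fun_value.
have dE : adjoint_dom S = dom T.
  by apply/seteqP; split=> k; [case=> h'; exact: sub | exists (T k); exact: ST].
split=> // k; rewrite inE => Ak; apply: (adjoint_value_unique dS).
  exact: adjoint_fun_value.
by apply: ST; rewrite -dE.
Qed.

Lemma op_eq_sym (U V : lmodType (scalar_field R s)) (A B : operator U V) :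
  op_eq A B -> op_eq B A.
Proof. by case=> dE fE; split=> // x; rewrite -dE => /fE. Qed.

End Adjoints.

Lemma adjoint_pairC (R : realType) (s : scalar_kind) (H K : hilbertType R s)
    (S : operator H K) (T : operator K H) :
  adjoint_pair S T -> adjoint_pair T S.
Proof. by move=> ST k h Tk Sh; rewrite innerC -ST // -innerC. Qed.

Lemma trivial_orthogonal_dense (R : realType) (s : scalar_kind)
    (H : hilbertType R s) (D : set H) : submod_closed (mem D) ->
  (forall z, (forall d, D d -> '<[d, z]> = 0) -> z = 0) -> dense D.
Proof.
move=> Dsub D0; apply: adherent_dense => x.
have [y Dy xy] := orthogonal_projection Dsub (@hilbert_complete R s H) x.
suff /eqP : x - y = 0 by rewrite subr_eq0 => /eqP->.
by apply: D0 => d /xy xyd; rewrite innerC [inner _ _]xyd rmorph0.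
Qed.

(** The graph of an adjoint is the orthogonal complement of the graph of [S]
    rotated by a right angle, [E] below. *)
Lemma adjoint_closed (R : realType) (s : scalar_kind) (H K : hilbertType R s)
    (S : operator H K) (T : operator K H) (dS : densely_defined S) :
  op_eq (adjoint dS) T -> closed_op T.
Proof.
move=> /adjoint_eqP[/adjoint_pairP ST sub]; apply/closed_adherent.
pose E := [set (S h, - h) | h in dom S].
have graphE p : graph T p <-> forall e, E e ->
    prod_ip (hilbert_ip K) (hilbert_ip H) p e = 0.
  have -> : (forall e, E e -> prod_ip (hilbert_ip K) (hilbert_ip H) p e = 0)
      <-> adjoint_value S p.1 p.2.
    have ortho h : '<[p.1, S h]> + '<[p.2, - h]> =
        sconj R s ('<[S h, p.1]> - '<[h, p.2]>).
      by rewrite rmorphB -!innerC -[- h]sub0r innerBr inner0r sub0r.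
    split=> [pE h|pS _ [h Sh <-]].
      rewrite inE => Sh; have : '<[p.1, S h]> + '<[p.2, - h]> = 0.
        by apply: (pE (_, _)); exists h.
      rewrite ortho => /eqP; rewrite fmorph_eq0 subr_eq0 => /eqP. exact.
    by rewrite prod_ipE /= [X in X + _]/= (ortho h) pS ?inE // subrr rmorph0.
  split; first by move=> [/= + ->]; rewrite inE => /ST.
  move=> pS; have Tp := sub _ _ pS; split; first by rewrite inE.
  by apply: (adjoint_value_unique dS pS); exact: ST.
move=> p Tp; apply/graphE; apply: adherent_orthogonal => e e0.
by have [a /graphE] := Tp e e0; exists a.
Qed.

(** * The block operator and the shifted products *)

Section Blocks.
Variables (R : realType) (s : scalar_kind).
Local Notation real := (of_real R s).

Lemma real_neq0 (l : R) : l != 0 -> real l != 0.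
Proof. by rewrite fmorph_eq0. Qed.

(** The sign change [(h, k) |-> (k, - h)] carries one block operator to the
    other. *)
Lemma block_swap (H K : hilbertType R s) (S : operator H K) (T : operator K H) c :
  ran (op_block S T c) = setT -> ran (op_block T S c) = setT.
Proof.
move=> /ran_full rM; apply/ran_full => -[a b].
have [[h k] /= [Sh Tk] [Mh Mk]] := rM (- b, a).
exists (k, - h); first by split=> //=; exact: domN.
rewrite /= /block_fun /= opN // opprK [c *: k + _]addrC Mk scalerN.
by rewrite -[T k - _]opprB Mh opprK.
Qed.

(** Pairing [S h] with [k] gives [- l |k|^2] one way and [l |h|^2] the other. *)
Lemma block_kernel (H K : hilbertType R s) (S : operator H K) (l : R) h k :
  l != 0 -> dom S h -> S h = - (real l *: k) ->
  adjoint_value S k (real l *: h) -> h = 0 /\ k = 0.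
Proof.
move=> l0 Sh ShE kE; have := kE h; rewrite inE ShE -scaleNr => /(_ Sh).
have -> : '<[- real l *: k, k]> = - real l * '<[k, k]>.
  exact: (ipZl (hilbert_ip K)).
have -> : '<[h, real l *: h]> = real l * '<[h, h]>.
  by rewrite [LHS](ipZr (hilbert_ip H)) sconj_of_real.
rewrite [inner k k](ip_sqn (hilbert_ip K)) [inner h h](ip_sqn (hilbert_ip H)).
rewrite -rmorphN -!rmorphM => /fmorph_inj /eqP.
rewrite mulNr -subr_eq0 -opprD oppr_eq0 -mulrDr mulf_eq0 (negPf l0) /=.
rewrite paddr_eq0 ?sqn_ge0 // => /andP[/eqP k0 /eqP h0].
by split; apply: sqn_eq0.
Qed.

Section Pair.
Variables (H K : hilbertType R s) (S : operator H K) (T : operator K H).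
Hypothesis ST : adjoint_pair S T.
Variable l : R.
Hypothesis l0 : l != 0.
Local Notation c := (real l).

(** The block equation for [(z, 0)], with [z] orthogonal to the domain, has only
    the trivial solution. *)
Lemma block_dense : ran (op_block S T c) = setT -> densely_defined S.
Proof.
move=> /ran_full rM; apply: trivial_orthogonal_dense (dom_submod S) _ => z zS.
have [[h k] /= [Sh Tk] [Mh Mk]] := rM (z, 0).
have [||h0 k0] := @block_kernel H K S l h k l0 Sh.
- by apply/eqP; rewrite -addr_eq0 Mk.
- move=> x Sx; rewrite ST ?inE //; last by rewrite -inE.
  have -> : T k = c *: h - z by rewrite -Mh opprB addrCA subrr addr0.
  by move: Sx; rewrite inE => Sx; rewrite innerBr zS ?subr0.
by move: Mh; rewrite h0 k0 operator0 scaler0 subr0.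
Qed.

(** If the adjoint of [S] takes [k] to [h'], the block equation for
    [(- h', l k)] is solved by [(0, k)] as soon as [k] lies in the domain of
    [T]; a solution exists anyway, and [block_kernel] forces its second
    component to be [k]. *)
Lemma block_adjoint (dS : densely_defined S) :
  ran (op_block S T c) = setT -> op_eq (adjoint dS) T.
Proof.
move=> /ran_full rM; apply/adjoint_eqP; split=> // k h' kh'.
have [[h0 k0] /= [Sh Tk] [Mh Mk]] := rM (- h', c *: k).
have [||_ /eqP] := @block_kernel H K S l h0 (k0 - k) l0 Sh.
- by rewrite scalerBr opprB -Mk addrK.
- have -> : c *: h0 = T k0 - h' by rewrite -Mh addrC subrK.
  have /adjoint_pairP/(_ _ Tk) k0E := ST.
  move=> x Sx; rewrite !innerBr k0E // kh' //.
by rewrite subr_eq0 => /eqP <-.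
Qed.

Lemma block_shift : ran (op_block S T c) = setT ->
  ran (op_shift (c ^+ 2) (op_comp S T)) = setT.
Proof.
move=> /ran_full rM; apply/ran_full => g.
have [[h k] /= [Sh Tk] [Mh Mk]] := rM (0, c^-1 *: g).
have TkE : T k = c *: h by apply/eqP; rewrite eq_sym -subr_eq0 Mh.
exists k; first by split=> //=; rewrite TkE; exact: domZ.
rewrite /= TkE opZ // expr2 -scalerA -scalerDr addrC Mk.
by rewrite scalerA divff ?scale1r // real_neq0.
Qed.

Lemma shift_block_snd g : ran (op_shift (c ^+ 2) (op_comp S T)) = setT ->
  exists2 p, dom (op_block S T c) p & op_block S T c p = (0, g).
Proof.
move=> /ran_full /(_ g)[k /= [Tk STk] kE].
exists (T k, c *: k); first by split=> //=; exact: domZ.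
by rewrite /= /block_fun /= opZ // subrr scalerA -expr2 addrC kE.
Qed.

Lemma shift_block_fst f : ran (op_shift (c ^+ 2) (op_comp T S)) = setT ->
  exists2 p, dom (op_block S T c) p & op_block S T c p = (f, 0).
Proof.
move=> /ran_full /(_ f)[h /= [Sh TSh] hE].
exists (c *: h, - S h); first by split=> /=; [exact: domZ|exact: domN].
by rewrite /= /block_fun /= opZ // opN // scalerN subrr opprK scalerA -expr2 hE.
Qed.

Lemma shift_block : ran (op_shift (c ^+ 2) (op_comp S T)) = setT ->
  ran (op_shift (c ^+ 2) (op_comp T S)) = setT -> ran (op_block S T c) = setT.
Proof.
move=> rK rH; apply/ran_full => -[f g].
have [p Mp pE] := shift_block_fst f rH; have [q Mq qE] := shift_block_snd g rK.
exists (p + q); first exact: domD.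
by rewrite opD // pE qE; congr pair; rewrite /= ?addr0 ?add0r.
Qed.

(** Split [(f, g)] along [D], the set of the pairs [(l h, S h)].  Since [S] is
    the adjoint of [T], [D] is the orthogonal complement of the set [E] of the
    pairs [(T k, - l k)], and therefore closed. *)
Lemma adjoint_block (dS : densely_defined S) (dT : densely_defined T) :
  op_eq (adjoint dS) T -> op_eq (adjoint dT) S -> ran (op_block S T c) = setT.
Proof.
move=> /adjoint_eqP[/adjoint_pairP SsubT subT] /adjoint_eqP[/adjoint_pairP TsubS subS].
pose B := prod_ip (hilbert_ip H) (hilbert_ip K).
pose E := [set (T k, - (c *: k)) | k in dom T].
pose D := [set w | forall e, E e -> B w e = 0].
have c0 : c != 0 := real_neq0 l0.
have DE p : D p <-> adjoint_value T (c^-1 *: p.1) p.2.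
  have ortho k : B p (T k, - (c *: k)) =
      sconj R s (c * ('<[T k, c^-1 *: p.1]> - '<[k, p.2]>)).
    have -> : '<[T k, c^-1 *: p.1]> = c^-1 * '<[T k, p.1]>.
      by rewrite [LHS](ipZr (hilbert_ip H)) -fmorphV sconj_of_real.
    rewrite mulrBr mulrA divff // mul1r rmorphB rmorphM sconj_of_real -!innerC.
    rewrite prod_ipE /= -scaleNr; congr (_ + _).
    by rewrite [LHS](ipZr (hilbert_ip K)) rmorphN sconj_of_real mulNr.
  split=> [Dp k|pE _ [k Tk <-]]; last first.
    by rewrite ortho pE ?inE // subrr mulr0 rmorph0.
  rewrite inE => Tk; have : B p (T k, - (c *: k)) = 0 by apply: Dp; exists k.
  rewrite ortho => /eqP; rewrite fmorph_eq0 mulf_eq0 (negPf c0) subr_eq0 => /eqP.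
  exact.
have Dsub : submod_closed (mem D).
  split=> [|a v w]; rewrite !inE; first by move=> e _; rewrite ip0l.
  by move=> Dv Dw e Ee; rewrite ip_linear Dv // Dw // mulr0 addr0.
have cB : complete_ip B by apply: complete_prod; exact: hilbert_complete.
apply/ran_full => -[f g].
have [y /adherent_orthogonal/DE yE xy] := orthogonal_projection Dsub cB (f, g).
have Sh := subS _ _ yE.
have ShE : S (c^-1 *: y.1) = y.2 := adjoint_value_unique dT (TsubS _ Sh) yE.
(* orthogonality of the remainder to [D], read as a value of the adjoint *)
have kE : adjoint_value S (g - y.2) (- (c *: (f - y.1))).
  move=> h; rewrite inE => Sh'.
  have /xy : D (c *: h, S h).
    by apply/DE; rewrite /= scalerA mulVf // scale1r; exact: TsubS.
  rewrite prod_ipE /= => /(congr1 (sconj R s)); rewrite rmorphD -!innerC rmorph0.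
  have -> : '<[c *: h, f - y.1]> = c * '<[h, f - y.1]>.
    exact: (ipZl (hilbert_ip H)).
  rewrite addrC => /eqP; rewrite addr_eq0 => /eqP ->.
  by rewrite -[- (c *: (f - _))]scaleNr [RHS](ipZr (hilbert_ip H)) rmorphN sconj_of_real mulNr.
have Tk := subT _ _ kE.
have TkE := adjoint_value_unique dS (SsubT _ Tk) kE.
exists (c^-1 *: y.1, c^-1 *: (g - y.2)); first by split=> //=; exact: domZ.
rewrite /= /block_fun /= ShE opZ // TkE scalerN !scalerA divff // mulVf //.
by rewrite !scale1r opprK addrC subrK addrC subrK.
Qed.

End Pair.

Section ClosedRange.
Variables (H K : hilbertType R s) (S : operator H K) (T : operator K H).
Hypothesis ST : adjoint_pair S T.
Variable l : R.
Hypothesis l0 : l != 0.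
Local Notation c := (real l).
Local Notation q := (sqn (hilbert_ip K)).
Local Notation A := (op_shift (c ^+ 2) (op_comp S T)).

(** Expanding the square, the cross term is [2 l^2 |T k|^2], which is
    nonnegative. *)
Lemma shift_bounded_below k : dom A k -> l ^+ 4 * q k <= q (A k).
Proof.
move=> [Tk STk] /=; set y := S (T k).
have y_k : rip (hilbert_ip K) y k = sqn (hilbert_ip H) (T k).
  by congr repart; apply: ST; rewrite inE.
have -> : c ^+ 2 *: k + y = y - real (- l ^+ 2) *: k.
  by rewrite addrC rmorphN rmorphXn scaleNr opprK.
rewrite sqnBZ y_k; have := sqn_ge0 (hilbert_ip K) y.
have := sqn_ge0 (hilbert_ip H) (T k); have := sqr_ge0 l.
move: (sqn _ (T k)) (q y) (q k) => a b d; nra.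
Qed.

(** By [shift_bounded_below], preimages of a convergent sequence in the range
    form a Cauchy sequence; its limit is in the domain since [S T] is closed. *)
Lemma shift_closed_range : closed_op (op_comp S T) ->
  closure (ran A) = setT -> ran A = setT.
Proof.
rewrite closure_adherent => /closed_adherent cST rA; apply/ran_full => y.
have /adherent_conv[v vA vy] : adherent (hilbert_ip K) (ran A) y by rewrite rA.
have {}/choice[u uv] n : exists x, dom A x /\ A x = v n.
  by have [x] := vA n; exists x.
have Au n : dom A (u n) by have [] := uv n.
have AE n : A (u n) = v n by have [] := uv n.
have l4 : 0 < l ^+ 4 by rewrite exprn_even_gt0.
have [e e0|x ux] := @hilbert_complete R s K u.
  have [N NP] := conv_cauchy vy (mulr_gt0 l4 e0); exists N => m n Nm Nn.
  rewrite -(ltr_pM2l l4); apply: le_lt_trans (NP m n Nm Nn).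
  by rewrite -!AE -opB //; apply: shift_bounded_below; exact: domB.
have STx : graph (op_comp S T) (x, y - c ^+ 2 *: x).
  apply: cST; apply: (@conv_adherent _ _ _ _ _
    (fun n => (u n, op_comp S T (u n)))) => [n|].
    by split=> //=; rewrite inE; exact: Au.
  apply: conv_prod => //=; rewrite -rmorphXn.
  apply: eq_conv (convBZ (l ^+ 2) vy ux) => n.
  by rewrite -AE /= rmorphXn addrC addKr.
case: STx => /=; rewrite inE => dx xE; exists x => //.
by rewrite [LHS]/= -[X in _ + X]xE addrC subrK.
Qed.

End ClosedRange.
End Blocks.

(** * The equivalences *)

Section Equivalences.
Variables (R : realType) (s : scalar_kind) (H K : hilbertType R s).
Variables (S : operator H K) (T : operator K H).
Local Notation M l := (op_block S T (of_real R s l)).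
Local Notation shiftK l := (op_shift (of_real R s l ^+ 2) (op_comp S T)).
Local Notation shiftH l := (op_shift (of_real R s l ^+ 2) (op_comp T S)).

Definition mutual_adjoints : Prop :=
  exists (dS : densely_defined S) (dT : densely_defined T),
    op_eq (adjoint dS) T /\ op_eq S (adjoint dT).

Lemma mutual_adjoints_pair : mutual_adjoints -> adjoint_pair S T.
Proof. by case=> dS [dT [/adjoint_eqP[]]]. Qed.

Lemma mutual_adjoints_block l :
  mutual_adjoints -> l != 0 -> ran (M l) = setT.
Proof.
by case=> dS [dT [ST TS]] l0; apply: (adjoint_block l0 ST); exact: op_eq_sym TS.
Qed.

Lemma mutual_adjoints_closed_dense : mutual_adjoints ->
  [/\ closed_op S, closed_op T, densely_defined S & densely_defined T].
Proof.
case=> dS [dT [ST TS]]; split=> //; last exact: adjoint_closed ST.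
exact: adjoint_closed (op_eq_sym TS).
Qed.

Lemma block_mutual_adjoints l : adjoint_pair S T -> l != 0 ->
  ran (M l) = setT -> mutual_adjoints.
Proof.
move=> ST l0 rM; have TS := adjoint_pairC ST; have rM' := block_swap rM.
have dS := block_dense ST l0 rM; have dT := block_dense TS l0 rM'.
exists dS, dT; split; first exact: block_adjoint rM.
exact/op_eq_sym/(block_adjoint TS l0).
Qed.

Lemma mutual_adjoints_shift l : mutual_adjoints -> l != 0 ->
  ran (shiftK l) = setT /\ ran (shiftH l) = setT.
Proof.
move=> i l0; have rM := mutual_adjoints_block i l0.
by split; apply: block_shift => //; exact: block_swap.
Qed.

End Equivalences.

Theorem theorem3p4 (R : realType) (s : scalar_kind) (H K : hilbertType R s)
    (S : operator H K) (T : operator K H) :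
  let i :=
    exists (dS : densely_defined S) (dT : densely_defined T),
      op_eq (adjoint dS) T /\ op_eq S (adjoint dT) in
  let ii_a := adjoint_pair S T in
  let ii_b (lambda : R) :=
    ran (op_block S T (of_real R s lambda)) = [set: (H * K)%type] in
  let iii_a := [/\ closed_op S, closed_op T,
                   densely_defined S & densely_defined T] in
  let iii_b := adjoint_pair S T in
  let iii_c (lambda : R) :=
    ran (op_shift (of_real R s lambda ^+ 2) (op_comp S T)) = [set: K] /\
    ran (op_shift (of_real R s lambda ^+ 2) (op_comp T S)) = [set: H] in
  let iii_c' (lambda : R) :=
    closure (ran (op_shift (of_real R s lambda ^+ 2) (op_comp S T)))
      = [set: K] /\
    closure (ran (op_shift (of_real R s lambda ^+ 2) (op_comp T S)))
      = [set: H] in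
  [<-> i;
       ii_a /\ (exists lambda : R, lambda != 0 /\ ii_b lambda);
       ii_a /\ (forall lambda : R, lambda != 0 -> ii_b lambda);
       [/\ iii_a, iii_b & exists lambda : R, lambda != 0 /\ iii_c lambda];
       [/\ iii_a, iii_b & forall lambda : R, lambda != 0 -> iii_c lambda]] /\
  (closed_op (op_comp S T) -> closed_op (op_comp T S) ->
   [<-> i;
        ii_a /\ (exists lambda : R, lambda != 0 /\ ii_b lambda);
        ii_a /\ (forall lambda : R, lambda != 0 -> ii_b lambda);
        [/\ iii_a, iii_b & exists lambda : R, lambda != 0 /\ iii_c' lambda];
        [/\ iii_a, iii_b & forall lambda : R, lambda != 0 -> iii_c' lambda]]).
Proof.
move=> i ii_a ii_b iii_a iii_b iii_c iii_c'.
have ii_i : ii_a /\ (exists l : R, l != 0 /\ ii_b l) -> i.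
  by case=> ST [l [l0]]; exact: block_mutual_adjoints.
have ii_some_all : ii_a /\ (exists l : R, l != 0 /\ ii_b l) ->
    ii_a /\ (forall l : R, l != 0 -> ii_b l).
  by move=> /[dup] -[ST _] /ii_i hi; split=> // l; exact: mutual_adjoints_block.
have i_ii : i -> ii_a /\ (exists l : R, l != 0 /\ ii_b l).
  move=> hi; split; first exact: mutual_adjoints_pair.
  exists 1; split; first exact: oner_neq0.
  by apply: mutual_adjoints_block => //; exact: oner_neq0.
have ii_all_i : ii_a /\ (forall l : R, l != 0 -> ii_b l) -> i.
  case=> ST rM; apply: ii_i; split=> //; exists 1.
  by split; [|apply: rM]; exact: oner_neq0.
have i_iii : i -> [/\ iii_a, iii_b & forall l : R, l != 0 -> iii_c l].
  move=> hi; split; first exact: mutual_adjoints_closed_dense.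
    exact: mutual_adjoints_pair.
  by move=> l; exact: mutual_adjoints_shift.
have iii_i l : iii_b -> l != 0 -> iii_c l -> i.
  by move=> ST l0 [rK rH]; apply: (block_mutual_adjoints ST l0); exact: shift_block.
have some_of_all (P : R -> Prop) : (forall l, l != 0 -> P l) -> exists l, l != 0 /\ P l.
  by move=> allP; exists 1; split; [|apply: allP]; exact: oner_neq0.
split=> [|cST cTS].
  tfae=> //.
  - by move=> /ii_all_i/i_iii[? ? /some_of_all].
  - by case=> _ ST [l [l0 /(iii_i _ ST l0)/i_iii]].
  - by case=> _ ST /some_of_all[l [l0 /(iii_i _ ST l0)]].
have closed_c l : iii_b -> l != 0 -> iii_c' l -> iii_c l.
  move=> ST l0 [rK rH]; split; first exact: shift_closed_range rK.
  by apply: shift_closed_range rH => //; exact: adjoint_pairC.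
have c_closed l : iii_c l -> iii_c' l.
  by case=> rK rH; rewrite /iii_c' rK rH !closureT.
have i_iii' : i -> [/\ iii_a, iii_b & forall l : R, l != 0 -> iii_c' l].
  by case/i_iii=> ? ? rc; split=> // l /rc /c_closed.
tfae=> //.
- by move=> /ii_all_i/i_iii'[? ? /some_of_all].
- by case=> _ ST [l [l0 /(closed_c _ ST l0)/(iii_i _ ST l0)/i_iii']].
- by case=> _ ST /some_of_all[l [l0 /(closed_c _ ST l0)/(iii_i _ ST l0)]].
Qed.
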